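(* Let $n\ge 1$ and let $\mathcal F$ be a $\mathcal B$-saturated family of subsets of $[n]$ containing exactly $k\ge 1$ singletons (sets of the form $\{i\}$). Then $|\mathcal F|\ge \binom{k}{2}+k(n-k)$.
   Context: Subsets of $[n]=\{1,\dots,n\}$ are ordered by inclusion. For finite posets $\mathcal P$ and $\mathcal Q$, $\mathcal P$ contains an induced copy of $\mathcal Q$ if there is an injective map $f:\mathcal Q\to\mathcal P$ such that for all $a,b\in\mathcal Q$, $a\le b$ if and only if $f(a)\le f(b)$. A family $\mathcal F$ of subsets of $[n]$ is $\mathcal Q$-saturated if $\mathcal F$ contains no induced copy of $\mathcal Q$, but for every $S\subseteq[n]$ with $S\notin\mathcal F$, $\mathcal F\cup\{S\}$ contains an induced copy of $\mathcal Q$. The butterfly $\mathcal B$ is the four-element poset $\{a_1,a_2,b_1,b_2\}$ in which $a_1,a_2$ are incomparable, $b_1,b_2$ are incomparable, and $a_i<b_j$ for all $i,j\in\{1,2\}$ (no other relations). *)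

(* Defs.v *)
(* MathComp world: [n] is 'I_n and a family of subsets of [n] is an element of
   {set {set 'I_n}}. *)
From HB Require Import structures.
From mathcomp Require Import all_boot all_order.

Set Implicit Arguments.
Unset Strict Implicit.
Unset Printing Implicit Defensive.

Import Order.TTheory.

(* F is viewed as a poset under inclusion. *)
Definition has_induced_copy d (Q : finPOrderType d) (T : finType)
    (F : {set {set T}}) : Prop :=
  exists f : Q -> {set T},
    [/\ injective f,
        forall a, f a \in F
      & forall a b, (a <= b)%O = (f a \subset f b)].

Definition saturated d (Q : finPOrderType d) (T : finType)
    (F : {set {set T}}) : Prop :=
  ~ has_induced_copy Q F /\
  forall S : {set T}, S \notin F -> has_induced_copy Q (S |: F).

Inductive butterfly : Type := a1 | a2 | b1 | b2.

Definition butterfly_code (x : butterfly) : bool * bool :=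
  match x with
  | a1 => (false, false) | a2 => (false, true)
  | b1 => (true, false)  | b2 => (true, true)
  end.

Definition butterfly_decode (p : bool * bool) : butterfly :=
  match p with
  | (false, false) => a1 | (false, true) => a2
  | (true, false) => b1  | (true, true) => b2
  end.

Lemma butterfly_codeK : cancel butterfly_code butterfly_decode.
Proof. by case. Qed.

HB.instance Definition _ := Finite.copy butterfly (can_type butterfly_codeK).

Definition butterfly_le (x y : butterfly) : bool :=
  match x, y with
  | a1, a1 | a2, a2 | b1, b1 | b2, b2 => true
  | a1, b1 | a1, b2 | a2, b1 | a2, b2 => true
  | _, _ => false
  end.

Lemma butterfly_le_refl : reflexive butterfly_le.
Proof. by case. Qed.

Lemma butterfly_le_anti : antisymmetric butterfly_le.
Proof. by case; case. Qed.

Lemma butterfly_le_trans : transitive butterfly_le.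
Proof. by case; case; case. Qed.

Fact butterfly_display : Order.disp_t.
Proof. exact: Order.Disp tt tt. Qed.

HB.instance Definition _ := Order.Le_isPOrder.Build butterfly_display butterfly
  butterfly_le_refl butterfly_le_anti butterfly_le_trans.

(* Main.v *)
(** Let K be the set of points whose singletons lie in F.  Every pair inside K
    must belong to F.  For i in K and j outside K, either {i, j} is in F, or
    some member A of F contains i, misses j, and lies with j below two
    incomparable members of F; for a maximal such A the set j |: A is in F.
    These sets C(i, j) trace {i} on K, so i can be read off C(i, j), and so can
    j: if j |: A = j' |: A' with j != j', then A and A' are incomparable and
    below two common incomparable members, which is a butterfly. *)
Require Import Defs.
From mathcomp Require Import all_boot all_order.

Set Implicit Arguments.
Unset Strict Implicit.
Unset Printing Implicit Defensive.

Section ButterflySaturation.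

Variable T : finType.
Implicit Types (A B S : {set T}) (F : {set {set T}}) (i j x : T).

(** * Butterflies as quadruples of sets *)

Definition incomparable A B := ~~ (A \subset B) && ~~ (B \subset A).

Lemma incomparable_sym A B : incomparable A B = incomparable B A.
Proof. by rewrite /incomparable andbC. Qed.

Lemma incomparable_irrefl A : incomparable A A = false.
Proof. by rewrite /incomparable subxx. Qed.

Lemma butterfly_copyP F :
  has_induced_copy butterfly F <->
  exists A1 A2 B1 B2,
    [/\ [/\ A1 \in F, A2 \in F, B1 \in F & B2 \in F],
        incomparable A1 A2, incomparable B1 B2,
        A1 :|: A2 \subset B1 & A1 :|: A2 \subset B2].
Proof.
split=> [[f [_ fF fle]]|].
  exists (f a1), (f a2), (f b1), (f b2).
  by rewrite /incomparable !subUset -!fle !fF.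
case=> A1 [A2 [B1 [B2 [[A1F A2F B1F B2F] iA iB sAB1 sAB2]]]].
move: sAB1 sAB2; rewrite !subUset => /andP[s11 s21] /andP[s12 s22].
case/andP: (iA) => nA12 nA21; case/andP: (iB) => nB12 nB21.
pose f q := match q with a1 => A1 | a2 => A2 | b1 => B1 | b2 => B2 end.
(* The strict relations come for free: a top contained in one bottom would place the other bottom
   inside it. *)
have nBA A A' B : ~~ (A' \subset A) -> A' \subset B -> (B \subset A) = false.
  by move=> nA sA; apply: contraNF nA; apply: subset_trans.
have fle a b : (a <= b)%O = (f a \subset f b).
  case: a b => [] [] /=; rewrite ?subxx ?s11 ?s12 ?s21 ?s22 //;
    by apply/esym; first [exact/negbTE | exact: nBA nA12 _ | exact: nBA nA21 _].
exists f; split=> //; last by case.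
by move=> a b eq_f; apply/eqP; rewrite Order.POrderTheory.eq_le !fle eq_f subxx.
Qed.

Lemma comparable_below F A1 A2 B1 B2 :
    ~ has_induced_copy butterfly F ->
    A1 \in F -> A2 \in F -> B1 \in F -> B2 \in F -> incomparable B1 B2 ->
    A1 \subset B1 -> A1 \subset B2 -> A2 \subset B1 -> A2 \subset B2 ->
  incomparable A1 A2 = false.
Proof.
move=> noB A1F A2F B1F B2F iB s11 s12 s21 s22; apply/negP => iA; apply: noB.
apply/butterfly_copyP; exists A1, A2, B1, B2.
by rewrite !subUset s11 s12 s21 s22.
Qed.

(** The butterfly created by adding [S] must use [S]; up to symmetry [S] is one of its tops (first
    case) or one of its bottoms (second case). *)
Lemma saturated_cases F S :
    saturated butterfly F -> S \notin F ->
  (exists A1 A2 B, [/\ A1 \in F, A2 \in F & B \in F] /\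
     [/\ incomparable A1 A2, incomparable B S,
         A1 :|: A2 \subset B & A1 :|: A2 \subset S]) \/
  (exists A B1 B2, [/\ A \in F, B1 \in F & B2 \in F] /\
     [/\ incomparable A S, incomparable B1 B2,
         A :|: S \subset B1 & A :|: S \subset B2]).
Proof.
case=> noB /[apply] /butterfly_copyP[A1 [A2 [B1 [B2]]]].
case=> -[A1F A2F B1F B2F] iA iB sAB1 sAB2.
have neq_inc A B : incomparable A B -> A != B.
  by apply: contraTneq => ->; rewrite incomparable_irrefl.
have neq_low A A' B : incomparable A A' -> A :|: A' \subset B -> B != A.
  rewrite subUset => /andP[_ nA] /andP[_ sA].
  by apply: contraNneq nA => <-.
have inF A : A \in S |: F -> A != S -> A \in F.
  by rewrite in_setU1 => /predU1P[->|//]; rewrite eqxx.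
have [eA1|nA1] := eqVneq A1 S.
  subst S; right; exists A2, B1, B2.
  rewrite (setUC A2) (incomparable_sym A2); split; last by split.
  split; apply: inF => //; [|exact: neq_low iA _|exact: neq_low iA _].
  by rewrite eq_sym neq_inc.
have [eA2|nA2] := eqVneq A2 S.
  subst S; right; exists A1, B1, B2; split; last by split.
  rewrite incomparable_sym in iA; rewrite !(setUC A1) in sAB1 sAB2.
  by split; apply: inF => //; [exact: neq_low iA _|exact: neq_low iA _].
have [eB1|nB1] := eqVneq B1 S.
  subst S; left; exists A1, A2, B2; rewrite (incomparable_sym B2).
  by split; split=> //; apply: inF => //; rewrite eq_sym neq_inc.
have [eB2|nB2] := eqVneq B2 S.
  subst S; left; exists A1, A2, B1.
  by split; split=> //; apply: inF.
case: noB; apply/butterfly_copyP; exists A1, A2, B1, B2.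
by split=> //; split; apply: inF.
Qed.

(** * Sets lying below two incomparable members *)

Definition below_two F S :=
  [exists B1 in F, [exists B2 in F,
     [&& incomparable B1 B2, S \subset B1 & S \subset B2]]].

Lemma below_twoP F S :
  reflect (exists B1 B2, [/\ B1 \in F, B2 \in F, incomparable B1 B2,
                             S \subset B1 & S \subset B2])
          (below_two F S).
Proof.
apply: (iffP exists_inP) => [[B1 B1F /exists_inP[B2 B2F /and3P[]]]|].
  by exists B1, B2.
case=> B1 [B2 [B1F B2F iB s1 s2]]; exists B1 => //.
by apply/exists_inP; exists B2 => //; apply/and3P.
Qed.

Lemma below_two_comparable F S A1 A2 :
    ~ has_induced_copy butterfly F -> below_two F S ->
    A1 \in F -> A2 \in F -> A1 \subset S -> A2 \subset S ->
  incomparable A1 A2 = false.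
Proof.
move=> noB /below_twoP[B1 [B2 [B1F B2F iB s1 s2]]] A1F A2F sA1 sA2.
by apply: (comparable_below noB A1F A2F B1F B2F iB);
  first [exact: subset_trans sA1 _ | exact: subset_trans sA2 _].
Qed.

(** A pair cannot be a top: incomparable sets [A1], [A2] inside it supply two distinct points, which
    exhaust the pair and lie in the other top [B], so the two tops would be comparable. *)
Lemma pair_cases F i j :
    saturated butterfly F -> [set i; j] \notin F ->
  exists A, [/\ A \in F, incomparable A [set i; j]
              & below_two F (A :|: [set i; j])].
Proof.
move=> satF /(saturated_cases satF)[|]; last first.
  case=> A [B1 [B2 [[AF B1F B2F] [iA iB s1 s2]]]]; exists A; split=> //.
  by apply/below_twoP; exists B1, B2.
case=> A1 [A2 [B [_ [/andP[]]]]].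
case/subsetPn=> x xA1 xA2 /subsetPn[y yA2 yA1] /andP[_ nS] sB.
move=> /subsetP sS; case/negP: nS.
have /sS := subsetP (subsetUl A1 A2) _ xA1.
have /sS := subsetP (subsetUr A1 A2) _ yA2.
have xB : x \in B by rewrite (subsetP sB) // inE xA1.
have yB : y \in B by rewrite (subsetP sB) // inE yA2 orbT.
have nxy : x != y by apply: contraNneq yA1 => <-.
rewrite !inE => ey ex; apply/subsetP => z; rewrite !inE.
move: nxy; case/orP: ey => /eqP ey; case/orP: ex => /eqP ex; subst;
  by rewrite ?eqxx // => _ /orP[] /eqP ->.
Qed.

Definition singleton_points F := [set i | [set i] \in F].

(** The members [[set i]] and [A] both lie in [S], hence are comparable; a nonempty [A] inside
    [[set i]] equals it. *)
Lemma singleton_in_below_two F i A S :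
    ~ has_induced_copy butterfly F -> below_two F S -> A \in F ->
    A \subset S -> i \in S -> i \in singleton_points F -> A != set0 ->
  i \in A.
Proof.
move=> noB bS AF AS iS; rewrite inE => iF A0.
have iS1 : [set i] \subset S by rewrite sub1set.
have := below_two_comparable noB bS iF AF iS1 AS.
rewrite /incomparable sub1set; case: (boolP (i \in A)) => //= iA /negbFE.
by rewrite subset1 (negPf A0) orbF => /eqP eA; rewrite eA set11 in iA.
Qed.

(* What survives of the maximality argument, for i in K and j outside K. *)
Definition extension F i j C :=
  [&& C \in F, j \in C, C :&: singleton_points F == [set i]
    & (C == [set i; j]) || (C :\ j \in F) && below_two F C].

(** * Members attached to a pair of points *)

Lemma pair_sub_cases F i j :
    saturated butterfly F -> i \in singleton_points F ->
    [set i; j] \notin F ->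
  exists A, [/\ A \in F, i \in A, j \notin A & below_two F (j |: A)].
Proof.
move=> satF iK nF; have [noB _] := satF.
have [A [AF /andP[nA1 nA2] bA]] := pair_cases satF nF.
have A0 : A != set0 by apply: contraNneq nA1 => ->; rewrite sub0set.
have iA : i \in A.
  by apply: (singleton_in_below_two noB bA); rewrite ?subsetUl // !inE eqxx orbT.
exists A; split=> //.
  by apply: contra nA2 => jA; rewrite subUset !sub1set iA.
suff -> : j |: A = A :|: [set i; j] by [].
apply/setP=> x; rewrite !inE orbC; have [->|//] := eqVneq x i.
by rewrite iA.
Qed.

(** Otherwise the set [A] avoiding [j] would be forced to contain [j], since [[set j]] is also a
    member. *)
Lemma singleton_pair_in F i j :
    saturated butterfly F -> i \in singleton_points F ->
    j \in singleton_points F ->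
  [set i; j] \in F.
Proof.
move=> satF iK jK; apply/negPn/negP => nF; have [noB _] := satF.
have [A [AF iA /negP jA bA]] := pair_sub_cases satF iK nF; apply: jA.
apply: (singleton_in_below_two noB bA); rewrite ?subsetU1 ?setU11 //.
by apply/set0Pn; exists i.
Qed.

Lemma extension_exists F i j :
    saturated butterfly F -> i \in singleton_points F ->
    j \notin singleton_points F ->
  exists C, extension F i j C.
Proof.
move=> satF iK jK; have [noB _] := satF.
have [pF|nF] := boolP ([set i; j] \in F).
  exists [set i; j]; rewrite /extension pF set22 eqxx andbT /=.
  apply/eqP/setP=> x; rewrite !inE; have [->|nxi] := eqVneq x i.
    by rewrite inE in iK.
  by have [->|//] := eqVneq x j; rewrite inE in jK; apply: negbTE.
pose P A := [&& A \in F, i \in A, j \notin A & below_two F (j |: A)].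
have [A0 [A0F iA0 jA0 bA0]] := pair_sub_cases satF iK nF.
have [|A /maxsetP[/and4P[AF iA jA bA] maxA] _] := @maxset_exists _ P A0.
  exact/and4P.
have trace : (j |: A) :&: singleton_points F = [set i].
  apply/setP=> x; rewrite in_setI in_set1; have [->|nxi] := eqVneq x i.
    by rewrite iK in_setU1 iA orbT.
  apply/negP=> /andP[xjA xK].
  have xF : [set i] \in F by rewrite inE in iK.
  have : x \in [set i].
    (* Here the member below [j |: A] is [[set i]] itself, so any other point of K is excluded. *)
    apply: (singleton_in_below_two noB bA) => //.
      by rewrite sub1set in_setU1 iA orbT.
    by apply/set0Pn; exists i; rewrite set11.
  by rewrite in_set1 (negPf nxi).
exists (j |: A); rewrite /extension setU11 trace eqxx (setU1K jA) AF bA orbT.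
rewrite !andbT; apply/negPn/negP => nCF.
(* As a top, [j |: A] would contain two incomparable members, which [bA] forbids. *)
have [[A1 [A2 [B [[A1F A2F _] [iA12 _ _]]]]]|] := saturated_cases satF nCF.
  by rewrite subUset => /andP[s1 s2]; rewrite (below_two_comparable noB bA) in iA12.
case=> A' [B1 [B2 [[A'F B1F B2F] [/andP[nA'C nCA'] iB s1 s2]]]].
have bS : below_two F (A' :|: (j |: A)) by apply/below_twoP; exists B1, B2.
(* As a bottom, [j |: A] has a partner [A']. Both [A] and [A'] lie in the set of [bS], so they are
   comparable, and [A'] inside [A] would put [A'] inside [j |: A]. *)
have AA' : A \subset A'.
  have sA : A \subset A' :|: (j |: A) by rewrite setUA subsetUr.
  have := below_two_comparable noB bS AF A'F sA (subsetUl _ _).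
  rewrite /incomparable; case: (A \subset A') => //= /negbFE sA'.
  by rewrite (subset_trans sA' (subsetUr _ _)) in nA'C.
(* [A'] is again a candidate: it misses [j], or else it would contain [j |: A]. Maximality then
   gives equality, yet [A] is comparable to [j |: A]. *)
have eA' : A' = A.
  apply: maxA => //; apply/and4P; split=> //; first exact: (subsetP AA').
    by apply: contra nCA' => jA'; rewrite subUset sub1set jA'.
  by move: bS; rewrite setUCA (setUidPl AA').
by rewrite eA' subsetUr in nA'C.
Qed.

Lemma extension_inj F i j i' j' C :
    ~ has_induced_copy butterfly F ->
    i \in singleton_points F -> j \notin singleton_points F ->
    i' \in singleton_points F -> j' \notin singleton_points F ->
    extension F i j C -> extension F i' j' C ->
  (i, j) = (i', j').
Proof.
move=> noB iK jK i'K j'K /and4P[_ jC /eqP trC eC] /and4P[_ j'C /eqP trC' eC'].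
have ei : i' = i by apply/set1P; rewrite -trC trC' set11.
subst i'; congr (i, _); apply/eqP.
have ni x : x \notin singleton_points F -> x != i.
  by apply: contraNneq => ->.
case/orP: eC => [/eqP eC|/andP[CjF bC]].
  by move: j'C; rewrite eC in_set2 (negPf (ni _ j'K)) eq_sym.
case/orP: eC' => [/eqP eC'|/andP[Cj'F _]].
  by move: jC; rewrite eC' in_set2 (negPf (ni _ jK)).
(* If [j] and [j'] differ, [C :\ j] and [C :\ j'] are incomparable members below [C]. *)
apply: contraFT (below_two_comparable noB bC CjF Cj'F _ _);
  rewrite ?subsetDl //.
move=> njj'; rewrite /incomparable; apply/andP; split; apply/subsetPn.
  by exists j'; rewrite !inE ?eqxx // eq_sym njj'.
by exists j; rewrite !inE ?eqxx // njj'.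
Qed.

(** * Counting pairs and extensions *)

Lemma card_saturated F :
    saturated butterfly F ->
  'C(#|singleton_points F|, 2) + #|singleton_points F| * #|~: singleton_points F|
    <= #|F|.
Proof.
move=> satF; have [noB _] := satF; set K := singleton_points F.
(* The default [set0] is never reached on [setX K (~: K)], by [extension_exists]. *)
pose g p := odflt set0 [pick C | extension F p.1 p.2 C].
have gP p : p \in setX K (~: K) -> extension F p.1 p.2 (g p).
  case: p => i j /setXP[/= iK]; rewrite in_setC => jK.
  rewrite /g; case: pickP => //= noC.
  by have [C] := extension_exists satF iK jK; rewrite noC.
have g_inj : {in setX K (~: K) &, injective g}.
  move=> [i j] [i' j'] p p' eg; have := gP _ p'; rewrite -eg; move: (gP _ p).
  move: p p' => /setXP[iK +] /setXP[i'K +]; rewrite !in_setC => jK j'K.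
  exact: extension_inj.
pose P := [set A : {set T} | A \subset K & #|A| == 2].
rewrite -cards_draws -/P -cardsX -(card_in_imset g_inj) -cardsUI.
(* The two kinds of members are told apart by their trace on K: two points for a pair inside K, one
   for an extension. *)
rewrite (_ : P :&: _ = set0) ?cards0 ?addn0; last first.
  apply/setP=> C; rewrite in_set0; apply/negP => /setIP[].
  rewrite inE => /andP[/setIidPl trC /eqP cC] /imsetP[p /gP/and4P[_ _ + _] eC].
  by rewrite -eC trC => /eqP e1; rewrite e1 cards1 in cC.
apply/subset_leq_card/subsetP => C /setUP[|/imsetP[p /gP/and4P[CF _ _ _] ->//]].
rewrite inE => /andP[sCK /cards2P[i [j [_ eC]]]]; move: sCK.
by rewrite eC subUset !sub1set => /andP[]; apply: singleton_pair_in.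
Qed.

End ButterflySaturation.

Unset Implicit Arguments.

Theorem theorem3 (n k : nat) (F : {set {set 'I_n}})
    (hn : 1 <= n) (hk : 1 <= k)
    (hsat : saturated butterfly F)
    (hsing : #|[set A in F | #|A| == 1]| = k) :
  'C(k, 2) + k * (n - k) <= #|F|.
Proof.
have eK : #|singleton_points F| = k.
  (* The singletons in [F] are the injective image of K under [set1]. *)
  rewrite -hsing -(card_imset _ (@set1_inj _)); apply: eq_card => A.
  rewrite inE; apply/imsetP/andP => [[i + ->]|[AF /cards1P[i eA]]].
    by rewrite inE cards1.
  by exists i; rewrite // inE -eA.
have eC : n - k = #|~: singleton_points F| by rewrite cardsCs setCK card_ord eK.
by rewrite eC -eK; apply: card_saturated.
Qed.
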